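(* Let $\varphi:\mathbb{R}^n\to\mathbb{R}\cup\{-\infty\}$ be a tropical rational function, and let $f\in\mathbb{T}[x_1^{\pm1},\dots,x_n^{\pm1}]$ and $g\in\mathbb{T}[x_1^{\pm1},\dots,x_n^{\pm1}]\setminus\{-\infty\}$ be tropical polynomials satisfying $\varphi=f\oslash g$. Then, regarding $f\oplus(x_{n+1}\odot g)$ as a tropical polynomial in $\mathbb{T}[x_1^{\pm1},\dots,x_{n+1}^{\pm1}]$, the following holds: $$\begin{aligned} V(f\oplus (x_{n+1}\odot g))=\ &\{(\mathbf{x},\varphi(\mathbf{x}))\in\mathbb{R}^{n+1}\mid \mathbf{x}\in\mathbb{R}^n,\ \varphi(\mathbf{x})\neq-\infty\}\\ &\cup\{(\mathbf{x},x_{n+1})\in\mathbb{R}^{n+1}\mid \mathbf{x}\in V(f),\ x_{n+1}<\varphi(\mathbf{x})\}\\ &\cup\{(\mathbf{x},x_{n+1})\in\mathbb{R}^{n+1}\mid \mathbf{x}\in V(g),\ x_{n+1}>\varphi(\mathbf{x})\}. \end{aligned}$$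
   Context: Tropical algebra: $\mathbb{T}=\mathbb{R}\cup\{-\infty\}$ with $x\oplus y=\max\{x,y\}$, $x\odot y=x+y$, and $x\oslash y=x-y$ for $y\ne-\infty$. A tropical polynomial (always meaning tropical Laurent polynomial) in $n$ variables is a formal expression $f=\bigoplus_{\mathbf{i}\in\mathbb{Z}^n}c_{\mathbf{i}}\mathbf{x}^{\mathbf{i}}$ with $c_{\mathbf{i}}\in\mathbb{T}$, only finitely many $c_{\mathbf{i}}\neq-\infty$; the set of these is $\mathbb{T}[x_1^{\pm1},\dots,x_n^{\pm1}]$, with the natural addition $\oplus$ and multiplication $\odot$. The polynomial all of whose coefficients are $-\infty$ is denoted $-\infty$. A tropical polynomial defines a function $\mathbb{R}^n\to\mathbb{R}\cup\{-\infty\}$ by $f(\mathbf{t})=\max_{\mathbf{i}}(c_{\mathbf{i}}+\mathbf{i}\cdot\mathbf{t})$. For $g\neq-\infty$, $f\oslash g$ is the function $\mathbf{t}\mapsto f(\mathbf{t})-g(\mathbf{t})$. A function $\varphi:\mathbb{R}^n\to\mathbb{R}\cup\{-\infty\}$ is a tropical rational function if $\varphi=f\oslash g$ for some tropical polynomials $f$ and $g\neq-\infty$. Tropical hypersurface: for $f=\bigoplus c_{\mathbf{i}}\mathbf{x}^{\mathbf{i}}\neq-\infty$, $V(f)$ is the set of $\mathbf{t}\in\mathbb{R}^n$ for which there exist $\mathbf{i}\neq\mathbf{j}$ in $\mathbb{Z}^n$ with $c_{\mathbf{i}}+\mathbf{i}\cdot\mathbf{t}=c_{\mathbf{j}}+\mathbf{j}\cdot\mathbf{t}=f(\mathbf{t})$.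 For $f=-\infty$ one sets $V(-\infty)=\mathbb{R}^n$. *)

(* Defs.v *)
From HB Require Import structures.
From mathcomp Require Import all_boot all_order all_algebra finmap.
From mathcomp Require Import all_classical all_reals.

Set Implicit Arguments.
Unset Strict Implicit.
Unset Printing Implicit Defensive.

Import Order.TTheory GRing.Theory Num.Theory.

Local Open Scope fset_scope.
Local Open Scope ring_scope.
Local Open Scope ereal_scope.

(* R together with -oo, as the extended reals other than +oo *)
Record trop (R : realType) := Trop {
  trop_val :> \bar R;
  trop_valP : trop_val != +oo }.

HB.instance Definition _ (R : realType) := [isSub for @trop_val R].
HB.instance Definition _ (R : realType) := [Choice of trop R by <:].

Definition tninf (R : realType) : trop R := @Trop R -oo isT.

Definition tfin (R : realType) (r : R) : trop R := @Trop R r%:E isT.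

Fact tadd_subproof (R : realType) (x y : trop R) :
  maxe (x : \bar R) y != +oo.
Proof. by rewrite maxEle; case: ifP => _; apply: trop_valP. Qed.

Definition tadd (R : realType) (x y : trop R) : trop R :=
  Trop (tadd_subproof x y).

Fact taddA (R : realType) : associative (@tadd R).
Proof. by move=> x y z; apply: val_inj => /=; rewrite maxA. Qed.

Fact taddC (R : realType) : commutative (@tadd R).
Proof. by move=> x y; apply: val_inj => /=; rewrite maxC. Qed.

Fact tadd_ninf (R : realType) : left_id (tninf R) (@tadd R).
Proof. by move=> x; apply: val_inj => /=; rewrite maxNye. Qed.

HB.instance Definition _ (R : realType) :=
  Monoid.isComLaw.Build (trop R) (tninf R) (@tadd R)
    (@taddA R) (@taddC R) (@tadd_ninf R).

Fact tmul_subproof (R : realType) (x y : trop R) :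
  (x : \bar R) + y != +oo.
Proof. by case: x y => [[r| |] // _] [[s| |] //]. Qed.

Definition tmul (R : realType) (x y : trop R) : trop R :=
  Trop (tmul_subproof x y).

(* Meaningful for y <> -oo; otherwise x - y = +oo and the value defaults
   to -oo. *)
Definition tdiv (R : realType) (x y : trop R) : trop R :=
  insubd (tninf R) ((x : \bar R) - y).

(* The coefficient family of a Laurent polynomial, indexed by exponent
   vectors in Z^n. *)
Notation tpoly R n := {fsfun 'rV[int]_n -> trop R with tninf R}.

Definition tpoly_ninf (R : realType) (n : nat) : tpoly R n := [fsfun].

Definition tpoly_add (R : realType) (n : nat) (f g : tpoly R n) : tpoly R n :=
  [fsfun i in finsupp f `|` finsupp g => tadd (f i) (g i)].

Definition tpoly_mul (R : realType) (n : nat) (f g : tpoly R n) : tpoly R n :=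
  [fsfun k in [fset (i + j)%R | i in finsupp f, j in finsupp g] =>
    \big[@tadd R/tninf R]_(i <- finsupp f) tmul (f i) (g (k - i)%R)].

Definition tpoly_var (R : realType) (n : nat) (k : 'I_n) : tpoly R n :=
  [fsfun i in [fset delta_mx ord0 k] => tfin 0%R].

(* f seen as a polynomial in one more variable: the last exponent is 0 *)
Definition tpoly_widen (R : realType) (n : nat) (f : tpoly R n) :
    tpoly R (n + 1) :=
  [fsfun k in [fset row_mx i (0 : 'rV[int]_1)%R | i in finsupp f] =>
    f (lsubmx k)].

Definition tpoly_term (R : realType) (n : nat) (f : tpoly R n)
    (i : 'rV[int]_n) (t : 'rV[R]_n) : trop R :=
  tmul (f i) (tfin (\sum_(k < n) (i ord0 k)%:~R * t ord0 k)%R).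

Definition tpoly_eval (R : realType) (n : nat) (f : tpoly R n)
    (t : 'rV[R]_n) : trop R :=
  \big[@tadd R/tninf R]_(i <- finsupp f) tpoly_term f i t.

Definition tpoly_quot (R : realType) (n : nat) (f g : tpoly R n)
    (t : 'rV[R]_n) : trop R :=
  tdiv (tpoly_eval f t) (tpoly_eval g t).

Definition trop_rational (R : realType) (n : nat)
    (phi : 'rV[R]_n -> trop R) : Prop :=
  exists f g : tpoly R n, g <> tpoly_ninf R n /\ phi = tpoly_quot f g.

Definition trop_hypersurface (R : realType) (n : nat) (f : tpoly R n) :
    set 'rV[R]_n :=
  if f == tpoly_ninf R n then setT else
  [set t | exists i j : 'rV[int]_n, [/\ i <> j,
     tpoly_term f i t = tpoly_term f j t &
     tpoly_term f j t = tpoly_eval f t]]%classic.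

Definition extend_pt (R : realType) (n : nat) (x : 'rV[R]_n) (y : R) :
    'rV[R]_(n + 1) :=
  row_mx x (const_mx y).

(* Main.v *)
Require Import Defs.
From HB Require Import structures.
From mathcomp Require Import all_boot all_order all_algebra finmap.
From mathcomp Require Import all_classical all_reals.

(** Put [h = f (+) x_(n+1) (.) g].  A monomial of [h] has last exponent 0 and
    comes from [f], or last exponent 1 and comes from [g]; the terms of [h] at
    [(x, y)] are therefore the terms of [f] at [x] together with the terms of
    [g] at [x] raised by [y] ([tpoly_term_graph]), and
    [h (x, y) = max (f x) (g x + y)] ([tpoly_eval_graph]).

    Since [g x] is finite, comparing [y] with [phi x = f x - g x] amounts to
    comparing [g x + y] with [f x].  When [y < phi x] the maximum is attained
    only by terms of [f], so [h] has two maximal terms at [(x, y)] exactly when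
    [f] has two at [x] ([hypersurface_graph_below]); when [phi x < y] the same
    holds with [g] ([hypersurface_graph_above]).  When [y = phi x] a maximal
    term of [f] and a maximal term of [g] are both maximal for [h], and their
    last exponents differ, so [(x, y)] always lies in the hypersurface
    ([hypersurface_graph_on]).  If [f = -oo] then [phi x = -oo < y] throughout,
    and only the second of these cases occurs. *)

Import Order.TTheory GRing.Theory Num.Theory.

Local Open Scope classical_set_scope.
Local Open Scope ereal_scope.

(** * Terms and values of a tropical polynomial *)

Lemma trop_val_inj {R : realType} : injective (@trop_val R).
Proof. exact: val_inj. Qed.

(** The value is defined as a maximum over the support, but exponents outside
    it contribute only -oo: the hypersurface quantifies over all exponents, so
    a bound in terms of all of them is what is needed. *)
Lemma tpoly_eval_leP {R : realType} {n : nat} (f : tpoly R n) (t : 'rV[R]_n)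
    (u : \bar R) :
  (tpoly_eval f t <= u) <-> (forall i, tpoly_term f i t <= u).
Proof.
have -> : trop_val (tpoly_eval f t) =
    \big[maxe/-oo]_(i <- finsupp f) trop_val (tpoly_term f i t).
  by apply: (big_morph (@trop_val R)).
split=> [le_u i|le_u]; last first.
  by elim/big_ind: _ => [|a b au bu|i _]; rewrite ?leNye ?ge_max ?au ?bu.
have [fi|fi] := boolP (i \in finsupp f).
  by apply: le_trans le_u; rewrite (big_fsetD1 i) //= le_max lexx.
by rewrite /tpoly_term (fsfun_dflt fi) /= addNye leNye.
Qed.

Lemma tpoly_term_le_eval {R : realType} {n : nat} (f : tpoly R n) i
    (t : 'rV[R]_n) :
  tpoly_term f i t <= tpoly_eval f t.
Proof. exact: (tpoly_eval_leP f t _).1. Qed.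

(** The polynomial -oo is no exception: all its terms have the value -oo. *)
Lemma tpoly_eval_attained {R : realType} {n : nat} (f : tpoly R n)
    (t : 'rV[R]_n) :
  exists i, tpoly_term f i t = tpoly_eval f t.
Proof.
have [ninf_f|//] : tpoly_eval f t = tninf R \/
    exists i, tpoly_term f i t = tpoly_eval f t.
  rewrite /tpoly_eval.
  elim/big_ind: _ => [|a b IHa IHb|i _]; [by left| |by right; exists i].
  have [->|->] : tadd a b = a \/ tadd a b = b.
    have [ab|ba] := leP (a : \bar R) b; [right|left]; apply: trop_val_inj => /=.
      exact/max_idPr.
    exact/max_idPl/ltW.
  - exact: IHa.
  - exact: IHb.
exists 0%R; apply: trop_val_inj; have := tpoly_term_le_eval f 0%R t.
by rewrite ninf_f /= leeNy_eq => /eqP.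
Qed.

(** A polynomial other than -oo has a real coefficient, and the corresponding
    monomial takes real values everywhere. *)
Lemma tpoly_eval_fin_num {R : realType} {n : nat} (f : tpoly R n)
    (t : 'rV[R]_n) :
  f <> tpoly_ninf R n -> (tpoly_eval f t : \bar R) \is a fin_num.
Proof.
move=> f_neq; rewrite fin_numE trop_valP andbT; apply/eqP => f_ninf.
apply: f_neq; apply/fsfunP => i; rewrite fsfun0E; apply: trop_val_inj.
have := tpoly_term_le_eval f i t; rewrite f_ninf leeNy_eq /=.
by case: (f i) => [[]].
Qed.

Lemma trop_hypersurfaceP {R : realType} {n : nat} (f : tpoly R n)
    (t : 'rV[R]_n) :
  f <> tpoly_ninf R n ->
  trop_hypersurface f t <-> exists i j,
    [/\ i <> j, tpoly_term f i t = tpoly_eval f t &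
        tpoly_term f j t = tpoly_eval f t].
Proof.
move=> /eqP /negPf f_neq; rewrite /trop_hypersurface f_neq.
by split=> -[i [j [ij fi fj]]]; exists i, j; split; rewrite // fi.
Qed.

(** * Coefficients of sums and products *)

Lemma tpoly_addE {R : realType} {n : nat} (f g : tpoly R n) i :
  tpoly_add f g i = tadd (f i) (g i).
Proof.
rewrite fsfunE in_fsetU; case: ifPn => //; rewrite negb_or => /andP[fi gi].
by rewrite (fsfun_dflt fi) (fsfun_dflt gi) tadd_ninf.
Qed.

Lemma tpoly_widenE {R : realType} {n : nat} (f : tpoly R n) (k : 'rV_(n + 1)) :
  tpoly_widen f k = if rsubmx k == 0%R then f (lsubmx k) else tninf R.
Proof.
rewrite fsfunE; case: imfsetP => [[i _ ->]|nk] /=.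
  by rewrite row_mxKl row_mxKr eqxx.
have [k0|//] := eqVneq (rsubmx k) 0%R; apply/esym.
have [fk|/fsfun_dflt//] := boolP (lsubmx k \in finsupp f).
by case: nk; exists (lsubmx k); rewrite // -k0 hsubmxK.
Qed.

Lemma finsupp_tpoly_var {R : realType} {n : nat} (k : 'I_n) :
  finsupp (tpoly_var R k) = [fset delta_mx ord0 k]%fset.
Proof.
apply/fsetP => i; rewrite mem_finsupp fsfunE in_fset1.
by case: ifP => // _; rewrite eqxx.
Qed.

(** Multiplying by a variable shifts exponents: only one summand of the
    convolution survives. *)
Lemma tpoly_mul_varE {R : realType} {n : nat} (k : 'I_n) (g : tpoly R n) m :
  tpoly_mul (tpoly_var R k) g m = g (m - delta_mx ord0 k)%R.
Proof.
rewrite fsfunE finsupp_tpoly_var big_seq_fset1.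
have -> : tmul (tpoly_var R k (delta_mx ord0 k))
    (g (m - delta_mx ord0 k)%R) = g (m - delta_mx ord0 k)%R.
  by apply: trop_val_inj; rewrite /= fsfunE in_fset1 eqxx add0e.
case: imfset2P => // nm; apply/esym/fsfun_dflt/negP => gm; case: nm.
by exists (delta_mx ord0 k); rewrite ?in_fset1 //;
  exists (m - delta_mx ord0 k)%R; rewrite // addrC subrK.
Qed.

(** * The polynomial [f (+) x_(n+1) (.) g] *)

Definition tpoly_graph {R : realType} {n : nat} (f g : tpoly R n) :
    tpoly R (n + 1) :=
  tpoly_add (tpoly_widen f)
    (tpoly_mul (tpoly_var R (rshift n (@ord0 0))) (tpoly_widen g)).

Lemma tpoly_graphE {R : realType} {n : nat} (f g : tpoly R n) i (c : int) :
  tpoly_graph f g (row_mx i (const_mx c)) =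
  if c == 0%R then f i else if c == 1%R then g i else tninf R.
Proof.
have const_mx_eq0 (d : int) : (const_mx d == 0 :> 'rV_1)%R = (d == 0%R).
  apply/eqP/eqP => [/(congr1 (fun A : 'rV_1 => A ord0 ord0))|->].
    by rewrite !mxE.
  by apply/rowP => ?; rewrite !mxE.
rewrite /tpoly_graph tpoly_addE tpoly_mul_varE.
have -> : delta_mx ord0 (rshift n (@ord0 0)) =
    row_mx (0 : 'rV[int]_n)%R (const_mx 1%R).
  apply/rowP => j; rewrite !mxE; case: splitP => l jl; rewrite mxE.
    by rewrite eqxx -val_eqE /= jl addn0 ltn_eqF.
  by rewrite eqxx -val_eqE /= jl (ord1 l) eqxx.
rewrite opp_row_mx add_row_mx subr0.
have -> : (const_mx c - const_mx 1 = const_mx (c - 1) :> 'rV[int]_1)%R.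
  by apply/rowP => ?; rewrite !mxE.
rewrite !tpoly_widenE !row_mxKl !row_mxKr !const_mx_eq0 subr_eq0.
have [->|_] := eqVneq c 0%R; last exact: tadd_ninf.
by rewrite eq_sym oner_eq0 taddC tadd_ninf.
Qed.

(** Last exponent 0 reproduces a term of [f] at [x], last exponent 1 a term of
    [g] raised by [y]; the whole comparison rests on this dichotomy. *)
Lemma tpoly_term_graph {R : realType} {n : nat} (f g : tpoly R n)
    (i : 'rV[int]_n) (c : int) (x : 'rV[R]_n) (y : R) :
  tpoly_term (tpoly_graph f g) (row_mx i (const_mx c)) (extend_pt x y) =
  if c == 0%R then tpoly_term f i x
  else if c == 1%R then tmul (tpoly_term g i x) (tfin y)
  else tninf R.
Proof.
apply: trop_val_inj; rewrite /tpoly_term /extend_pt tpoly_graphE /=.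
rewrite big_split_ord /= big_ord1 !row_mxEr !mxE.
under eq_bigr do rewrite !row_mxEl.
have [->|_] := eqVneq c 0%R; first by rewrite mul0r addr0.
have [->|_] /= := eqVneq c 1%R; last by rewrite addNye.
by rewrite mul1r EFinD addeA.
Qed.

Lemma row_mx_last {T : Type} {n : nat} (v : 'rV[T]_(n + 1)) :
  exists w c, v = row_mx w (const_mx c).
Proof.
exists (lsubmx v), (rsubmx v ord0 ord0); rewrite -[LHS]hsubmxK; congr row_mx.
by apply/rowP => j; rewrite !mxE !ord1.
Qed.

Lemma tpoly_eval_graph {R : realType} {n : nat} (f g : tpoly R n)
    (x : 'rV[R]_n) (y : R) :
  tpoly_eval (tpoly_graph f g) (extend_pt x y) =
  tadd (tpoly_eval f x) (tmul (tpoly_eval g x) (tfin y)).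
Proof.
apply: trop_val_inj; apply/le_anti/andP; split; last first.
  rewrite /= ge_max; apply/andP; split.
    apply/tpoly_eval_leP => i.
    by have := tpoly_term_le_eval (tpoly_graph f g) (row_mx i (const_mx 0%R))
      (extend_pt x y); rewrite tpoly_term_graph.
  have [i gi] := tpoly_eval_attained g x; rewrite -gi.
  by have := tpoly_term_le_eval (tpoly_graph f g) (row_mx i (const_mx 1%R))
    (extend_pt x y); rewrite tpoly_term_graph.
apply/tpoly_eval_leP => k; have [i [c ->]] := row_mx_last k.
rewrite tpoly_term_graph /= le_max.
case: ifP => _; first by rewrite tpoly_term_le_eval.
case: ifP => _; last by rewrite leNye.
by rewrite leeD2r ?tpoly_term_le_eval ?orbT.
Qed.

Lemma tpoly_graph_neq_ninf {R : realType} {n : nat} (f g : tpoly R n) :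
  g <> tpoly_ninf R n -> tpoly_graph f g <> tpoly_ninf R (n + 1).
Proof.
move=> g_neq h0; apply: g_neq; apply/fsfunP => i.
by have := tpoly_graphE f g i 1%R; rewrite h0 !fsfun0E.
Qed.

(** * The hypersurface over each point of the base *)

(** If all maximal terms of [h] at [(x, y)] have the same last exponent [c], and
    they correspond to the maximal terms at [x] of some [p], then two distinct
    ones exist for [h] exactly when they do for [p].  Used with [p = f], [c = 0]
    on one side of the graph of [phi] and with [p = g], [c = 1] on the other. *)
Lemma hypersurface_graph_fiber {R : realType} {n : nat} (f g p : tpoly R n)
    (c : int) (x : 'rV[R]_n) (y : R) :
  let h := tpoly_graph f g in
  let q := extend_pt x y in
  g <> tpoly_ninf R n -> p <> tpoly_ninf R n ->
  (forall i, tpoly_term h (row_mx i (const_mx c)) q = tpoly_eval h q <->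
             tpoly_term p i x = tpoly_eval p x) ->
  (forall i d, tpoly_term h (row_mx i (const_mx d)) q = tpoly_eval h q ->
               d = c) ->
  trop_hypersurface h q <-> trop_hypersurface p x.
Proof.
move=> h q g_neq p_neq max_c only_c.
have maximal k : tpoly_term h k q = tpoly_eval h q ->
    exists2 i, k = row_mx i (const_mx c) & tpoly_term p i x = tpoly_eval p x.
  have [i [d ->]] := row_mx_last k => max_k.
  by exists i; [rewrite (only_c _ _ max_k)|apply/max_c; rewrite -(only_c _ _ max_k)].
have h_neq : h <> tpoly_ninf R (n + 1) by exact: tpoly_graph_neq_ninf.
rewrite !trop_hypersurfaceP //; split=> -[].
  move=> k [l [kl /maximal[i ki pi] /maximal[j lj pj]]].
  by exists i, j; split=> // ij; apply: kl; rewrite ki lj ij.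
move=> i [j [ij /max_c pi /max_c pj]].
exists (row_mx i (const_mx c)), (row_mx j (const_mx c)).
by split=> // /eq_row_mx[].
Qed.

(** Strict inequality rules out every term of [g] as a maximal term; it also
    forces [f] to differ from -oo, so that its hypersurface is given by pairs of
    terms. *)
Lemma hypersurface_graph_below {R : realType} {n : nat} (f g : tpoly R n)
    (x : 'rV[R]_n) (y : R) :
  g <> tpoly_ninf R n -> tpoly_eval g x + y%:E < tpoly_eval f x ->
  trop_hypersurface (tpoly_graph f g) (extend_pt x y) <-> trop_hypersurface f x.
Proof.
move=> g_neq lt_gf.
have f_neq : f <> tpoly_ninf R n.
  move=> f0; move: lt_gf.
  by rewrite f0 /tpoly_eval finsupp0 big_seq_fset0 /= ltNge leNye.
have evalE : tpoly_eval (tpoly_graph f g) (extend_pt x y) = tpoly_eval f x.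
  rewrite tpoly_eval_graph; apply: trop_val_inj => /=; exact/max_idPl/ltW.
apply: (@hypersurface_graph_fiber _ _ _ _ _ 0%R) => // i; rewrite evalE.
  by rewrite tpoly_term_graph.
move=> d; rewrite tpoly_term_graph; have [//|_] := eqVneq d 0%R.
case: ifP => _ max_k; move: lt_gf; rewrite -max_k /= ltNge ?leNye //.
by rewrite leeD2r ?tpoly_term_le_eval.
Qed.

(** The mirror image of the previous case; here [f = -oo] is possible, and the
    argument is unaffected because the maximal terms are those of [g]. *)
Lemma hypersurface_graph_above {R : realType} {n : nat} (f g : tpoly R n)
    (x : 'rV[R]_n) (y : R) :
  g <> tpoly_ninf R n -> tpoly_eval f x < tpoly_eval g x + y%:E ->
  trop_hypersurface (tpoly_graph f g) (extend_pt x y) <-> trop_hypersurface g x.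
Proof.
move=> g_neq lt_fg.
have evalE : tpoly_eval (tpoly_graph f g) (extend_pt x y) =
    tmul (tpoly_eval g x) (tfin y).
  rewrite tpoly_eval_graph; apply: trop_val_inj => /=; exact/max_idPr/ltW.
apply: (@hypersurface_graph_fiber _ _ _ _ _ 1%R) => // i; rewrite evalE.
  rewrite tpoly_term_graph /=; split=> [/(congr1 (@trop_val R))/=|->//].
  by move/(congr1 (fun z => z - y%:E)); rewrite !addeK // => max_i; exact: trop_val_inj.
move=> d; rewrite tpoly_term_graph; have [_|_] := eqVneq d 0%R.
  move=> /(congr1 (@trop_val R))/= max_k; move: lt_fg; rewrite -max_k.
  by rewrite ltNge tpoly_term_le_eval.
have [//|_] := eqVneq d 1%R.
by move=> /(congr1 (@trop_val R))/= max_k; move: lt_fg; rewrite -max_k ltNge leNye.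
Qed.

(** A maximal term of [f] and a maximal term of [g] tie here; they are distinct
    monomials because their last exponents are 0 and 1. *)
Lemma hypersurface_graph_on {R : realType} {n : nat} (f g : tpoly R n)
    (x : 'rV[R]_n) (y : R) :
  g <> tpoly_ninf R n -> tpoly_eval f x = tmul (tpoly_eval g x) (tfin y) ->
  trop_hypersurface (tpoly_graph f g) (extend_pt x y).
Proof.
move=> g_neq eq_fg; apply/trop_hypersurfaceP.
  exact: tpoly_graph_neq_ninf.
have [i fi] := tpoly_eval_attained f x; have [j gj] := tpoly_eval_attained g x.
exists (row_mx i (const_mx 0%R)), (row_mx j (const_mx 1%R)).
rewrite !tpoly_term_graph /= fi gj tpoly_eval_graph eq_fg.
split; [|by apply: trop_val_inj; rewrite /= maxxx..].
move=> /eq_row_mx[_ /(congr1 (fun A : 'rV_1 => A ord0 ord0))].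
by rewrite !mxE.
Qed.

(** [g x] is finite, so the default value of the quotient is never taken. *)
Lemma tpoly_quotE {R : realType} {n : nat} (f g : tpoly R n) (x : 'rV[R]_n) :
  g <> tpoly_ninf R n ->
  tpoly_quot f g x = tpoly_eval f x - tpoly_eval g x :> \bar R.
Proof.
move=> /(tpoly_eval_fin_num g x); rewrite /tpoly_quot /tdiv => g_fin.
rewrite [LHS](@insubdK _ _ (trop R)) // unfold_in.
move: (trop_valP (tpoly_eval f x)) g_fin.
by case: (trop_val (tpoly_eval f x)) (trop_val (tpoly_eval g x)) => [r||] [s||].
Qed.

Theorem theorem1p1 (R : realType) (n : nat) (phi : 'rV[R]_n -> trop R)
    (f g : tpoly R n)
    (phi_rational : trop_rational phi)
    (g_neq : g <> tpoly_ninf R n)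
    (phiE : phi = tpoly_quot f g) :
  trop_hypersurface
    (tpoly_add (tpoly_widen f)
       (tpoly_mul (tpoly_var R (rshift n (@ord0 0))) (tpoly_widen g))) =
  [set p | exists x : 'rV[R]_n,
     phi x <> tninf R /\ p = extend_pt x (fine (phi x))]
  `|` [set p | exists (x : 'rV[R]_n) (y : R),
     [/\ trop_hypersurface f x, y%:E < phi x & p = extend_pt x y]]
  `|` [set p | exists (x : 'rV[R]_n) (y : R),
     [/\ trop_hypersurface g x, phi x < y%:E & p = extend_pt x y]].
Proof.
rewrite -/(tpoly_graph f g).
have lt_phi x y : (y%:E < phi x) = (tpoly_eval g x + y%:E < tpoly_eval f x).
  rewrite phiE tpoly_quotE // lteBrDr ?tpoly_eval_fin_num //.
  by rewrite addeC.
have phi_lt x y : (phi x < y%:E) = (tpoly_eval f x < tpoly_eval g x + y%:E).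
  rewrite phiE tpoly_quotE // lteBlDr ?tpoly_eval_fin_num //.
  by rewrite addeC.
have phi_eq x y : phi x = tfin y ->
    tpoly_eval f x = tmul (tpoly_eval g x) (tfin y).
  move=> phixy; apply: trop_val_inj => /=; apply/le_anti.
  by rewrite !leNgt -lt_phi -phi_lt phixy /= ltxx.
apply/seteqP; split=> p.
  have [x [y ->]] := row_mx_last p; rewrite -/(extend_pt x y) => hp.
  have [y_lt|y_gt|y_eq] := ltgtP y%:E (phi x : \bar R).
  - left; right; exists x, y; split=> //.
    by apply: (hypersurface_graph_below f g x y g_neq _).1 hp; rewrite // -lt_phi.
  - right; exists x, y; split=> //.
    by apply: (hypersurface_graph_above f g x y g_neq _).1 hp; rewrite // -phi_lt.
  - left; left; exists x; rewrite -y_eq; split=> // phix.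
    by rewrite phix in y_eq.
move=> [[[x [phix ->]]|[x [y [fx y_lt ->]]]]|[x [y [gx y_gt ->]]]].
- apply: hypersurface_graph_on => //; apply: phi_eq; apply: trop_val_inj.
  rewrite /= fineK // fin_numE trop_valP andbT.
  by apply/eqP => phix_ninf; apply: phix; apply: trop_val_inj.
- by apply: (hypersurface_graph_below f g x y g_neq _).2; rewrite // -lt_phi.
- by apply: (hypersurface_graph_above f g x y g_neq _).2; rewrite // -phi_lt.
Qed.
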